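(* Let $\eta_1,\eta_2>0$, $p\ge1$, and let $p'$ be the conjugate exponent of $p$. For each $c\in\{-1,0,1\}$ there is a constant $K>0$ depending only on $p,\eta_1,\eta_2$ and $c$ such that for all $0<b<\frac{1}{1-H(-c)}$, $$b^{\frac{1-H(c)}{2p'}}\left(\frac{\eta_1-H(c)+1}{2}\right){}_2F_1\left(\frac{1+H(c)-\eta_2}{2},\frac{\eta_1-H(c)+1}{2};\frac{\eta_1-H(c)+3}{2};cb\right)$$ $$\le K\left(\frac{p\eta_1-H(c)+1}{2}\right)^{\frac1p}\left[{}_2F_1\left(\frac{1+H(c)-p\eta_2}{2},\frac{p\eta_1-H(c)+1}{2};\frac{p\eta_1-H(c)+3}{2};cb\right)\right]^{\frac1p}.$$ As special cases, with constants $K$ depending only on $p,\eta_1,\eta_2$: for all $b>0$, $$\left(\frac{b}{1+b}\right)^{\frac1{2p'}}\left(\frac{\eta_1+1}{2}\right){}_2F_1\left(\frac{1-\eta_2}{2},1;\frac{\eta_1+3}{2};\frac{b}{1+b}\right)\le K\left(\frac{p\eta_1+1}{2}\right)^{\frac1p}\left[{}_2F_1\left(\frac{1-p\eta_2}{2},1;\frac{p\eta_1+3}{2};\frac{b}{1+b}\right)\right]^{\frac1p},$$ and for all $0<b<1$, $$\frac{\eta_1}{2}\,{}_2F_1\left(1-\frac{\eta_2}{2},\frac{\eta_1}{2};1+\frac{\eta_1}{2};b\right)\le K\left(\frac{p\eta_1}{2}\right)^{\frac1p}\left[{}_2F_1\left(1-\frac{p\eta_2}{2},\frac{p\eta_1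}{2};1+\frac{p\eta_1}{2};b\right)\right]^{\frac1p}.$$
   Context: $H$ is the Heaviside function: $H(s)=1$ for $s\ge0$ and $H(s)=0$ for $s<0$. The bound $\frac{1}{1-H(-c)}$ is read as $+\infty$ when $H(-c)=1$ (i.e. $c=0,-1$), and equals $1$ for $c=1$. The conjugate exponent satisfies $\frac1p+\frac1{p'}=1$, with $\frac1{p'}=0$ for $p=1$. Gauss' hypergeometric function is $${}_2F_1(\alpha,\beta;\gamma;z)=\frac{\Gamma(\gamma)}{\Gamma(\beta)\Gamma(\gamma-\beta)}\int_0^1\frac{u^{\beta-1}(1-u)^{\gamma-\beta-1}}{(1-zu)^\alpha}\,\mathrm{d}u,$$ for $\mathrm{Re}\,\gamma>\mathrm{Re}\,\beta>0$, $z\notin[1,\infty)$. *)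

(* Defs.v *)
From HB Require Import structures.
From mathcomp Require Import all_boot all_order all_algebra.
From mathcomp Require Import all_classical all_reals all_analysis.

Set Implicit Arguments.
Unset Strict Implicit.
Unset Printing Implicit Defensive.

Import Order.TTheory GRing.Theory Num.Theory.
Import numFieldNormedType.Exports.

Local Open Scope classical_set_scope.
Local Open Scope ring_scope.

Definition heaviside (R : realType) (s : R) : R := if 0 <= s then 1 else 0.

(* The reciprocal of the conjugate exponent of p: the conjugate exponent lives
   in \bar R, and (+oo)^-1 = 0, so that the value is 0 at p = 1. *)
Definition inv_conjugate (R : realType) (p : R) : R :=
  fine ((hoelder_conjugate p%:E)^-1)%E.

(* Euler's Gamma function, for s > 0. *)
Definition Gamma (R : realType) (s : R) : R :=
  \int[@lebesgue_measure R]_(t in `]0, +oo[) (t `^ (s - 1) * expR (- t)).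

(* Gauss' hypergeometric function 2F1(alpha, beta; gamma; z) for real
   parameters with gamma > beta > 0 and real z < 1.  On the open interval
   ]0, 1[ the bases u, 1 - u and 1 - z * u of the real powers are all positive,
   so that the conventions of powR outside of the positive reals are not
   involved. *)
Definition hyp2F1 (R : realType) (alpha beta gamma z : R) : R :=
  Gamma gamma / (Gamma beta * Gamma (gamma - beta)) *
  \int[@lebesgue_measure R]_(u in `]0, 1[)
    (u `^ (beta - 1) * (1 - u) `^ (gamma - beta - 1) /
     (1 - z * u) `^ alpha).

(* Main.v *)
(* The bound is uniform in b because, up to an explicit power of 1 - z, both
   hypergeometric functions stay between two positive constants.  For
   0 <= z < 1 and 0 < u < 1 one has 1 - u <= 1 - z u <= 1, so that the Euler
   integral lies between the beta integrals B(beta, gamma - beta) and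
   B(beta, gamma - beta - alpha), in an order given by the sign of alpha.  For
   z <= 0 one has u <= (1 - z u) / (1 - z) <= 1, so that (1 - z)^alpha times the
   Euler integral lies between B(beta, gamma - beta) and
   B(beta - alpha, gamma - beta).  The second estimate settles c = -1, where
   the powers of 1 + b match:
   1 / (2 p') - (1 - eta2) / 2 = - (1 - p eta2) / (2 p).
   The first one settles all the other cases. *)
Require Import Defs.
From mathcomp Require Import all_boot all_order all_algebra.
From mathcomp Require Import all_classical all_reals all_analysis.
From mathcomp Require Import measurable_realfun ring lra.

Import Order.TTheory GRing.Theory Num.Theory.
Import numFieldNormedType.Exports.

Local Open Scope ring_scope.

Section EulerIntegrals.
Context {R : realType}.
Local Notation mu := (@lebesgue_measure R).
Local Open Scope classical_set_scope.

(** * Integrability and positivity of beta integrals on the open unit interval *)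

(** The interval is exhausted by compact subintervals. On each of them the fundamental theorem of
    calculus bounds the integral of [f] by [M - m], and monotone convergence carries this bound to
    the limit. The integrand may thus blow up at either end. *)
Lemma integrable_bounded_primitive (f F : R -> R) (m M : R) :
  measurable_fun setT f ->
  {in `]0, 1[%R, forall x, 0 <= f x} ->
  {in `]0, 1[%R, continuous f} ->
  {in `]0, 1[%R, forall x : R, is_derive x (1 : R) F (f x)} ->
  {in `]0, 1[%R, forall x, m <= F x <= M} ->
  mu.-integrable `]0, 1[ (EFin \o f).
Proof.
move=> mf f0 cf dF bF.
(* Starting at 1/3 makes every [[e n, 1 - e n]] nondegenerate, as the fundamental theorem of
   calculus requires. *)
pose e n : R := n.+3%:R^-1.
have e0 n : 0 < e n by rewrite invr_gt0.
have e3 n : e n <= 3^-1 by rewrite lef_pV2 ?posrE// ler_nat.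
have e2 n : e n < 1 - e n by have := e3 n; lra.
pose J n : set R := `[e n, 1 - e n].
have JI n x : J n x -> x \in `]0, 1[%R.
  by rewrite /J/= !in_itv/= => /andP[? ?]; have := e0 n; lra.
have UJ : \bigcup_n J n = `]0, 1[.
  apply/seteqP; split => [x [n _ /JI]//|x /=].
  rewrite in_itv/= => /andP[x0 x1].
  have mx0 : 0 < Num.min x (1 - x) by rewrite lt_min x0 subr_gt0.
  have [n _ /(_ _ (leqnn _)) /=] := near_infty_natSinv_lt (PosNum mx0).
  rewrite lt_min => /andP[nx n1x]; exists n => //; rewrite /J/= in_itv/=.
  have : e n <= n.+1%:R^-1 by rewrite lef_pV2 ?posrE// ler_nat (leqW (leqW (leqnn _))).
  by move=> en; rewrite (ltW (le_lt_trans en nx)) lerBrDr -lerBrDl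
    (ltW (le_lt_trans en n1x)).
apply/integrableP; split; first by apply/measurable_EFinP/measurable_funTS.
under eq_integral => x /[!inE] x01 do rewrite /= ger0_norm ?f0//.
rewrite -UJ.
have ndJ : nondecreasing_seq J.
  move=> n k nk; rewrite subsetEset => x; rewrite /J/= !in_itv/=.
  have : e k <= e n by rewrite lef_pV2 ?posrE// ler_nat.
  lra.
have cvgJ : (\int[mu]_(x in J i) (f x)%:E @[i --> \oo] -->
    \int[mu]_(x in \bigcup_i J i) (f x)%:E)%E.
  apply: ge0_nondecreasing_set_cvg_integral => //.
  - by move=> i; exact: measurable_itv.
  - by move=> i; apply/measurable_EFinP/measurable_funTS.
  - by move=> i x /JI /f0; rewrite lee_fin.
rewrite -(cvg_lim _ cvgJ)//; apply: (@le_lt_trans _ _ (M - m)%:E); last exact: ltry.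
apply: lime_le; first by apply/cvg_ex; eexists; exact: cvgJ.
apply: nearW => n.
have sub x : x \in `]e n, 1 - e n[%R -> x \in `]0, 1[%R.
  by rewrite !in_itv/= => /andP[? ?]; have := e0 n; lra.
have dJ : {in `[e n, 1 - e n]%R, forall x, derivable F x 1}.
  by move=> x /JI /dF [].
rewrite (@continuous_FTC2 _ f F)//.
- have Fl : m <= F (e n) <= M.
    by apply: bF; rewrite in_itv/=; have := e0 n; have := e2 n; lra.
  have Fr : m <= F (1 - e n) <= M.
    by apply: bF; rewrite in_itv/=; have := e0 n; have := e2 n; lra.
  rewrite -EFinB lee_fin; lra.
- by apply: continuous_in_subspaceT => x /[!inE] /JI /cf.
- have /(continuous_within_itvP _ (e2 n))[_ ? ?] := derivable_within_continuous dJ.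
  by split => // x /sub /dF [].
- by move=> x /sub /dF []; rewrite derive1E.
Qed.

(** The primitive u^a / a stays between 0 and 1/a, even when a < 1 makes the integrand unbounded at
    0. *)
Lemma integrable_powR01 (a : R) : 0 < a ->
  mu.-integrable `]0, 1[ (EFin \o (fun u => u `^ (a - 1))).
Proof.
move=> a0.
have dF (x : R) : x \in `]0, 1[%R ->
    is_derive x 1 (fun u => a^-1 * u `^ a) (x `^ (a - 1)).
  rewrite in_itv/= => /andP[x0 _].
  have -> : x `^ (a - 1) = a^-1 *: (a * x `^ (a - 1)).
    by rewrite /GRing.scale/= mulrA mulVf ?mul1r// gt_eqF.
  exact: (is_deriveZ a^-1 (is_derive1_powR a x0)).
apply: (@integrable_bounded_primitive _ (fun u => a^-1 * u `^ a) 0 a^-1).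
- exact: measurable_powR.
- by move=> x _; exact: powR_ge0.
- move=> x; rewrite in_itv/= => /andP[x0 _].
  apply/differentiable_continuous/derivable1_diffP.
  by apply: derivable_powR; rewrite in_itv/= x0.
- exact: dF.
- move=> x; rewrite in_itv/= => /andP[x0 x1].
  rewrite mulr_ge0 ?invr_ge0 ?powR_ge0 ?(ltW a0)//=.
  rewrite ler_piMr ?invr_ge0 ?(ltW a0)//.
  by rewrite -(powRr0 x); apply: ger_powR; rewrite ?x0 ?ltW.
Qed.

Lemma measurable_onem_powR (r : R) :
  measurable_fun setT (fun u : R => (1 - u) `^ r).
Proof.
apply: (@measurableT_comp _ _ _ _ _ _ (fun u : R => u `^ r) _ (fun u : R => 1 - u)).
  exact: measurable_powR.
exact: measurable_funB.
Qed.

Lemma integrable_onem_powR01 (d : R) : 0 < d ->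
  mu.-integrable `]0, 1[ (EFin \o (fun u => (1 - u) `^ (d - 1))).
Proof.
move=> d0.
have inv (x : R) : x \in `]0, 1[%R -> 0 < 1 - x <= 1.
  by rewrite in_itv/=; lra.
have donem (x : R) : is_derive x 1 (fun u : R => 1 - u) (- 1).
  have := is_deriveB (is_derive_cst (1 : R) x 1) (is_derive_id x 1).
  by rewrite sub0r.
have dpow r (x : R) : x \in `]0, 1[%R ->
    is_derive x 1 (fun u => (1 - u) `^ r) (- (r * (1 - x) `^ (r - 1))).
  move=> /inv /andP[x1 _].
  have := @is_derive1_comp R (fun u => u `^ r) (fun u => 1 - u) x _ _
    (is_derive1_powR r x1) (donem x).
  by rewrite mulrN1.
have dF (x : R) : x \in `]0, 1[%R ->
    is_derive x 1 (fun u => - d^-1 * (1 - u) `^ d) ((1 - x) `^ (d - 1)).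
  move=> x01.
  have -> : (1 - x) `^ (d - 1) = - d^-1 *: (- (d * (1 - x) `^ (d - 1))).
    by rewrite /GRing.scale/= mulrNN mulrA mulVf ?mul1r// gt_eqF.
  exact: (is_deriveZ (- d^-1) (dpow d x x01)).
(* The mirrored primitive -(1 - u)^d / d is increasing, with values between -1/d and 0. *)
apply: (@integrable_bounded_primitive _ (fun u => - d^-1 * (1 - u) `^ d) (- d^-1) 0).
- exact: measurable_onem_powR.
- by move=> x _; exact: powR_ge0.
- move=> x x01; apply/differentiable_continuous/derivable1_diffP.
  by have [] := dpow (d - 1) x x01.
- exact: dF.
- move=> x /inv /andP[x0 x1]; rewrite mulNr lerN2 oppr_le0.
  rewrite mulr_ge0 ?invr_ge0 ?powR_ge0 ?(ltW d0)// andbT.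
  rewrite ler_piMr ?invr_ge0 ?(ltW d0)//.
  by rewrite -[leRHS](powRr0 (1 - x)); apply: ger_powR; rewrite ?x0 ?x1 ?(ltW d0).
Qed.

(** If the integral were zero, [f] would vanish almost everywhere on [D]. As [f] vanishes nowhere on
    [D], the set [D] would then be negligible. *)
Lemma Rintegral_gt0 (D : set R) (f : R -> R) :
  measurable D -> (0 < mu D)%E -> mu.-integrable D (EFin \o f) ->
  (forall x, D x -> 0 < f x) -> 0 < \int[mu]_(x in D) f x.
Proof.
move=> mD muD intf f0.
rewrite lt_neqAle Rintegral_ge0 ?andbT; last by move=> x /f0 /ltW.
apply/eqP => /esym If0.
have /integrableP[mf _] := intf.
have : (\int[mu]_(x in D) `|(f x)%:E| = 0)%E.
  rewrite -[RHS](congr1 EFin If0) /Rintegral fineK; last exact: integrable_fin_num.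
  by apply: eq_integral => x /[!inE] /f0 /ltW ?; rewrite gee0_abs.
move=> /(ae_eq_integral_abs mu mD mf) ae0.
have : mu.-negligible D.
  apply: negligibleS ae0 => x Dx /= /(_ Dx) [] fx0.
  by have := f0 x Dx; rewrite fx0 ltxx.
by move/(negligibleP mu mD) => mu0; rewrite mu0 ltxx in muD.
Qed.

(** The bound is 1 for r >= 0 and (1/2)^r for r < 0; their sum serves both signs. *)
Lemma powR_le_near1 (r x : R) : 2^-1 <= x <= 1 -> x `^ r <= 1 + 2^-1 `^ r.
Proof.
move=> /andP[x2 x1]; have x0 : 0 < x by lra.
have [r0|r0] := leP 0 r.
  rewrite (@le_trans _ _ 1)// ?lerDl ?powR_ge0//.
  by rewrite -[leRHS](powRr0 x); apply: ger_powR; rewrite ?x0.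
rewrite (@le_trans _ _ (2^-1 `^ r))// ?lerDr//.
rewrite -(opprK r) !(powRN _ (- r)) lef_pV2 ?posrE ?powR_gt0//.
by apply: ge0_ler_powR; rewrite ?nnegrE//; lra.
Qed.

Lemma measurable_beta (a d : R) :
  measurable_fun setT (fun u : R => u `^ (a - 1) * (1 - u) `^ (d - 1)).
Proof.
apply: measurable_funM; first exact: measurable_powR.
exact: measurable_onem_powR.
Qed.

(** Each factor is singular at one end at most. On either half of the interval one factor is bounded
    by the constant [C], so the product is dominated by [C] times the sum of the two integrable
    powers. *)
Lemma integrable_beta (a d : R) : 0 < a -> 0 < d ->
  mu.-integrable `]0, 1[ (EFin \o (fun u => u `^ (a - 1) * (1 - u) `^ (d - 1))).
Proof.
move=> a0 d0.
have mf := measurable_beta a d.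
set C := 1 + 2^-1 `^ (a - 1) + 2^-1 `^ (d - 1).
have Ca : 1 + 2^-1 `^ (a - 1) <= C by rewrite lerDl powR_ge0.
have Cd : 1 + 2^-1 `^ (d - 1) <= C by rewrite /C addrAC lerDl powR_ge0.
have I12 : mu.-integrable `]0, 1[
    (fun x => C%:E * ((x `^ (a - 1))%:E + ((1 - x) `^ (d - 1))%:E))%E.
  apply: integrableZl; first exact: measurable_itv.
  apply: integrableD; first exact: measurable_itv.
    exact: integrable_powR01.
  exact: integrable_onem_powR01.
apply: le_integrable I12; first exact: measurable_itv.
  exact/measurable_EFinP/measurable_funTS.
move=> x /=; rewrite in_itv/= => /andP[x0 x1].
have C0 : 0 <= C by rewrite !addr_ge0 ?powR_ge0.
rewrite lee_fin !ger0_norm; last 2 first.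
- by rewrite mulr_ge0 ?addr_ge0 ?powR_ge0.
- by rewrite mulr_ge0 ?powR_ge0.
have [x2|x2] := leP x 2^-1.
  apply: (@le_trans _ _ (x `^ (a - 1) * C)).
    rewrite ler_wpM2l ?powR_ge0// (le_trans _ Cd)// powR_le_near1//; lra.
  by rewrite mulrC ler_wpM2l// lerDl powR_ge0.
apply: (@le_trans _ _ (C * (1 - x) `^ (d - 1))).
  rewrite ler_wpM2r ?powR_ge0// (le_trans _ Ca)// powR_le_near1//; lra.
by rewrite ler_wpM2l// lerDr powR_ge0.
Qed.

Lemma beta_integral_gt0 (a d : R) : 0 < a -> 0 < d ->
  0 < \int[mu]_(u in `]0, 1[) (u `^ (a - 1) * (1 - u) `^ (d - 1)).
Proof.
move=> a0 d0; apply: Rintegral_gt0; first exact: measurable_itv.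
- by rewrite lebesgue_measure_itv/= lte_fin ltr01 -EFinB lte_fin subr0.
- exact: integrable_beta.
- move=> x; rewrite /= in_itv/= => /andP[x0 x1].
  by rewrite mulr_gt0 ?powR_gt0 ?subr_gt0.
Qed.

(** * Convergence and positivity of the Gamma integral *)

Lemma powR_le_expR_half (s : R) :
  exists2 C : R, 0 <= C & forall t, 1 <= t -> t `^ s <= C * expR (t / 2).
Proof.
(* For t >= 1, t^s is at most t^(n+1), since n + 1 exceeds |s|. One term of the exponential series
   at t/2 bounds (t/2)^(n+1) / (n+1)! by exp(t/2). *)
pose n := Num.truncn `|s|; pose c : R := n.+1`!%:R.
have c0 : 0 < c by rewrite ltr0n fact_gt0.
exists (2 ^+ n.+1 * c) => [|t t1]; first by rewrite mulr_ge0 ?exprn_ge0 ?(ltW c0).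
apply: (@le_trans _ _ (t ^+ n.+1)).
  rewrite -powR_mulrn; last lra.
  apply: ler_powR => //; apply: (le_trans (ler_norm s)); apply: ltW.
  exact: truncnS_gt.
have t0 : 0 <= t / 2 by lra.
have tE : t ^+ n.+1 = 2 ^+ n.+1 * c * ((t / 2) ^+ n.+1 / c).
  by rewrite mulrACA -exprMn divff ?gt_eqF// mulr1 mulrCA divff ?mulr1// gt_eqF.
have := expR_ge1Dxn n t0; rewrite -/c => H.
rewrite tE ler_wpM2l ?mulr_ge0 ?exprn_ge0 ?(ltW c0)//.
by apply: le_trans H; rewrite lerDr.
Qed.

Lemma integrable_Gamma (s : R) : 0 < s ->
  mu.-integrable `]0, +oo[ (EFin \o (fun t => t `^ (s - 1) * expR (- t))).
Proof.
move=> s0; have [C C0 HC] := powR_le_expR_half (s - 1).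
have mg : measurable_fun setT (fun t : R => t `^ (s - 1) * expR (- t)).
  apply: measurable_funM; first exact: measurable_powR.
  by apply: (measurableT_comp (@measurable_expR R)); exact: oppr_measurable.
(* The dominating function is t^(s-1) below 1 and a multiple of exp(-t/2) elsewhere. The factor 2
   cancels the normalisation 1/2 of the exponential density of rate 1/2. *)
pose h (t : R) : \bar R := ((((fun u : R => u `^ (s - 1)) \_ `]0%R, 1%R[) t)%:E +
  (C * 2)%:E * (exponential_pdf 2^-1 t)%:E)%E.
have I12 : mu.-integrable setT h.
  apply: integrableD => //.
    suff : mu.-integrable setT ((EFin \o (fun u => u `^ (s - 1))) \_ `]0, 1[).
      by rewrite restrict_EFin.
    by rewrite -integrable_mkcond; [exact: integrable_powR01|exact: measurable_itv].
  by apply: integrableZl => //; exact: integrable_exponential_pdf.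
have {}I12 : mu.-integrable `]0, +oo[ h by apply: integrableS I12.
apply: le_integrable I12;
  [exact: measurable_itv|exact/measurable_EFinP/measurable_funTS|].
move=> t /=; rewrite in_itv/= andbT => t0.
rewrite exponential_pdfE ?(ltW t0)// patchE.
have p0 : 0 <= t `^ (s - 1) by exact: powR_ge0.
have e0 := expR_ge0 (- t).
have e20 := expR_ge0 (- 2^-1 * t).
have [t1|t1] := ltP t 1.
  rewrite mem_set/=; last by rewrite in_itv/= t0.
  rewrite lee_fin !ger0_norm ?mulr_ge0//; last by rewrite addr_ge0// !mulr_ge0.
  rewrite ler_wpDr// ?mulr_ge0// ler_piMr// -expR0 ler_expR; lra.
rewrite memNset/=; last by rewrite in_itv/= => /andP[_]; rewrite ltNge t1.
rewrite add0r lee_fin !ger0_norm ?mulr_ge0//.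
rewrite mulrA mulfK//.
have -> : expR (- 2^-1 * t) = expR (t / 2) * expR (- t).
  by rewrite -expRD; congr expR; field.
by rewrite mulrA ler_wpM2r// HC.
Qed.

Lemma Gamma_gt0 (s : R) : 0 < s -> 0 < Gamma s.
Proof.
move=> s0; apply: Rintegral_gt0; first exact: measurable_itv.
- by rewrite lebesgue_measure_itv/= ltry addye.
- exact: integrable_Gamma.
- move=> x; rewrite /= in_itv/= andbT => x0.
  by rewrite mulr_gt0 ?powR_gt0 ?expR_gt0.
Qed.

(** * Pinching Euler integrals between beta integrals *)

Lemma powRN_between (e w r : R) : 0 < e -> e <= w <= 1 ->
  if 0 <= r then 1 <= w `^ (- r) <= e `^ (- r)
  else e `^ (- r) <= w `^ (- r) <= 1.
Proof.
move=> e0 /andP[ew w1]; have w0 : 0 < w by exact: lt_le_trans ew.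
have [r0|r0] := leP 0 r.
  rewrite -[X in X <= _ <= _](powRr0 w) ger_powR ?w0 ?oppr_le0//=.
  by rewrite !powRN lef_pV2 ?posrE ?powR_gt0// ge0_ler_powR ?nnegrE ?(ltW e0) ?(ltW w0).
have Nr0 : 0 <= - r by lra.
rewrite ge0_ler_powR ?nnegrE ?(ltW e0) ?(ltW w0)//=.
by rewrite -[leRHS](powRr0 w) ger_powR ?w0 ?w1.
Qed.

(** The function [e] is a lower envelope for the admissible [w]. At the extremes w = 1 and w = e the
    integrand is a beta integrand, with exponents [a], [d] and [a'], [d'] respectively. Monotonicity
    of w^(-r) puts every other case between these two, so [m] and [M] do not depend on [w]. *)
Lemma euler_integral_bounds (a d a' d' r : R) (e : R -> R) :
  0 < a -> 0 < d -> 0 < a' -> 0 < d' ->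
  (forall u : R, 0 < u < 1 -> 0 < e u /\
    u `^ (a - 1) * (1 - u) `^ (d - 1) * e u `^ (- r) =
    u `^ (a' - 1) * (1 - u) `^ (d' - 1)) ->
  exists m M : R, 0 < m /\ forall w : R -> R, measurable_fun setT w ->
    (forall u : R, 0 < u < 1 -> e u <= w u <= 1) ->
    mu.-integrable `]0, 1[
      (EFin \o (fun u => u `^ (a - 1) * (1 - u) `^ (d - 1) / w u `^ r)) /\
    m <= \int[mu]_(u in `]0, 1[)
      (u `^ (a - 1) * (1 - u) `^ (d - 1) / w u `^ r) <= M.
Proof.
move=> a0 d0 a'0 d'0 He.
pose g := fun u : R => u `^ (a - 1) * (1 - u) `^ (d - 1).
pose g' := fun u : R => u `^ (a' - 1) * (1 - u) `^ (d' - 1).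
have ig : mu.-integrable `]0, 1[ (EFin \o g) by exact: integrable_beta.
have ig' : mu.-integrable `]0, 1[ (EFin \o g') by exact: integrable_beta.
have pg : 0 < \int[mu]_(u in `]0, 1[) g u by exact: beta_integral_gt0.
have pg' : 0 < \int[mu]_(u in `]0, 1[) g' u by exact: beta_integral_gt0.
have mg : measurable_fun setT g by exact: measurable_beta.
have [g0 [g1 [ig0 ig1 pg0 Hg]]] : exists g0 g1 : R -> R,
  [/\ mu.-integrable `]0, 1[ (EFin \o g0), mu.-integrable `]0, 1[ (EFin \o g1),
      0 < \int[mu]_(u in `]0, 1[) g0 u &
      forall u : R, 0 < u < 1 -> forall w, e u <= w <= 1 ->
        g0 u <= g u / w `^ r <= g1 u].
  have gE u : 0 < u < 1 -> forall w, e u <= w <= 1 ->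
      if 0 <= r then g u <= g u / w `^ r <= g' u
      else g' u <= g u / w `^ r <= g u.
    move=> u01 w ew; have [e0 ge] := He u u01.
    have gu : 0 <= g u by rewrite mulr_ge0 ?powR_ge0.
    have := powRN_between _ _ r e0 ew; rewrite -powRN /g' -ge -/(g u).
    case: ifP => _ /andP[h1 h2].
    - by rewrite -[X in X <= _ <= _]mulr1 !ler_wpM2l.
    - by rewrite -[X in _ <= _ <= X]mulr1 !ler_wpM2l.
  (* The sign of [r] decides which of the two beta integrands is the smaller. *)
  case: (leP 0 r) gE => _ gE; first by exists g, g'.
  by exists g', g.
exists (\int[mu]_(u in `]0, 1[) g0 u), (\int[mu]_(u in `]0, 1[) g1 u).
split=> // w mw Hw.
have I : mu.-integrable `]0, 1[ (EFin \o (fun u => g u / w u `^ r)).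
  have mf : measurable_fun setT (fun u => g u / w u `^ r).
    apply: measurable_funM => //.
    apply: (eq_measurable_fun (fun u => w u `^ (- r))).
      by move=> u _; rewrite powRN.
    apply: (@measurableT_comp _ _ _ _ _ _ (fun u : R => u `^ (- r)) _ w) => //.
  apply: le_integrable ig1;
    [exact: measurable_itv|exact/measurable_EFinP/measurable_funTS|].
  move=> u /=; rewrite in_itv/= => u01.
  have /andP[_ h] := Hg u u01 _ (Hw u u01).
  rewrite lee_fin ger0_norm; last first.
    by rewrite mulr_ge0 ?invr_ge0 ?powR_ge0// mulr_ge0 ?powR_ge0.
  by rewrite (le_trans h)// ler_norm.
split=> //; apply/andP; split; apply: le_Rintegral => //;
  try exact: measurable_itv;
  by move=> u /=; rewrite in_itv/= => u01; have /andP[] := Hg u u01 _ (Hw u u01).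
Qed.

(** * Uniform two-sided bounds for the hypergeometric function *)

Lemma measurable_affine (z : R) : measurable_fun setT (fun u : R => 1 - z * u).
Proof. by apply: measurable_funB => //; exact: measurable_funM. Qed.

Lemma hyp2F1_const_gt0 (beta gamma : R) : 0 < beta -> beta < gamma ->
  0 < Gamma gamma / (Gamma beta * Gamma (gamma - beta)).
Proof.
move=> b0 bg; rewrite divr_gt0 ?mulr_gt0 ?Gamma_gt0 ?subr_gt0//.
exact: lt_trans bg.
Qed.

(** The envelope of 1 - z u is 1 - u. It lowers the second beta parameter to gamma - beta - alpha,
    whose positivity is the condition [alpha + beta < gamma]. *)
Lemma hyp2F1_bounds_nonneg (alpha beta gamma : R) :
  0 < beta -> beta < gamma -> alpha + beta < gamma ->
  exists m M : R, 0 < m /\ forall z, 0 <= z < 1 ->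
    m <= hyp2F1 alpha beta gamma z <= M.
Proof.
move=> b0 bg abg; have c0 := hyp2F1_const_gt0 _ _ b0 bg.
have [||||u /andP[u0 u1]|m [M [m0 H]]] := @euler_integral_bounds beta (gamma - beta) beta
  (gamma - beta - alpha) alpha (fun u => 1 - u) => //; try lra.
  split; first by rewrite subr_gt0.
  rewrite -mulrA -powRD; last by apply/implyP => _; rewrite subr_eq0 gt_eqF.
  by congr (_ * _ `^ _); ring.
exists (Gamma gamma / (Gamma beta * Gamma (gamma - beta)) * m),
  (Gamma gamma / (Gamma beta * Gamma (gamma - beta)) * M).
split=> [|z /andP[z0 z1]]; first exact: mulr_gt0.
have [u /andP[u0 u1]|_ /andP[h1 h2]] := H _ (measurable_affine z).
  by rewrite lerD2l lerN2 ler_piMl ?(ltW u0) ?(ltW z1)//= gerBl mulr_ge0// ltW.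
by rewrite /hyp2F1 !ler_wpM2l// ltW.
Qed.

(** After division by its maximum 1 - z, the base 1 - z u has the envelope u. This lowers the first
    beta parameter to beta - alpha, positive by [alpha < beta]. The division accounts for the factor
    (1 - z)^alpha. *)
Lemma hyp2F1_bounds_nonpos (alpha beta gamma : R) :
  0 < beta -> beta < gamma -> alpha < beta ->
  exists m M : R, 0 < m /\ forall z, z <= 0 ->
    m <= (1 - z) `^ alpha * hyp2F1 alpha beta gamma z <= M.
Proof.
move=> b0 bg ab; have c0 := hyp2F1_const_gt0 _ _ b0 bg.
have [||||u /andP[u0 u1]|m [M [m0 H]]] := @euler_integral_bounds beta (gamma - beta)
  (beta - alpha) (gamma - beta) alpha id => //; try lra.
  split=> //; rewrite mulrAC -powRD; last by apply/implyP => _; rewrite gt_eqF.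
  by congr (_ `^ _ * _); ring.
exists (Gamma gamma / (Gamma beta * Gamma (gamma - beta)) * m),
  (Gamma gamma / (Gamma beta * Gamma (gamma - beta)) * M).
split=> [|z z0]; first exact: mulr_gt0.
have z1 : 0 < 1 - z by lra.
have mw : measurable_fun setT (fun u : R => (1 - z * u) / (1 - z)).
  by apply: measurable_funM => //; exact: measurable_affine.
have [u /andP[u0 u1]|I /andP[h1 h2]] := H _ mw.
  rewrite ler_pdivlMr// ler_pdivrMr//; nra.
have -> : (1 - z) `^ alpha * hyp2F1 alpha beta gamma z =
    Gamma gamma / (Gamma beta * Gamma (gamma - beta)) *
    \int[mu]_(u in `]0, 1[) (u `^ (beta - 1) * (1 - u) `^ (gamma - beta - 1) /
      ((1 - z * u) / (1 - z)) `^ alpha).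
  rewrite /hyp2F1 mulrCA; congr (_ * _).
  have zr0 : (1 - z) `^ alpha != 0 by rewrite gt_eqF ?powR_gt0.
  (* The power of 1 - z crosses the integral sign thanks to the integrability [I] supplied together
     with the bounds. *)
  apply: (mulfI (invr_neq0 zr0)); rewrite mulKf// -RintegralZl;
    [|exact: measurable_itv|exact: I].
  apply: eq_Rintegral => u /[!inE]/=; rewrite in_itv/= => /andP[u0 u1].
  have zu : 0 <= 1 - z * u by nra.
  have iv : (1 - z)^-1 `^ alpha = ((1 - z) `^ alpha)^-1.
    by rewrite -(powR_inv1 (ltW z1)) -powRrM mulN1r powRN.
  rewrite powRM ?invr_ge0 ?(ltW z1)// iv.
  by rewrite invfM invrK [RHS]mulrC -[RHS]mulrA mulfK.
by rewrite !ler_wpM2l// ltW.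
Qed.

End EulerIntegrals.

(** * The conjugate exponent and the comparison of bounded quantities *)

Lemma inv_conjugateE (R : realType) (p : R) : 1 <= p ->
  inv_conjugate p = 1 - p^-1.
Proof.
move=> p1; have p0 : p != 0 by rewrite gt_eqF// (lt_le_trans ltr01).
have pE : p%:E != 0%E by rewrite eqe.
have := hoelder_conjugate_eq1 (ltNyr p) pE.
rewrite /inv_conjugate inver (negbTE p0).
(* In 1/p + 1/p' = 1 the finite right-hand side excludes an infinite reciprocal. *)
case: (_^-1)%E => [r [<-]| |]//=.
by rewrite addrAC subrr add0r.
Qed.

Lemma compare_bounds (R : realType) (c1 c2 m M q : R) :
  0 < c1 -> 0 < c2 -> 0 < m -> 0 <= q ->
  exists K : R, 0 < K /\ forall A B : R, A <= M -> m <= B ->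
    c1 * A <= K * c2 `^ q * B `^ q.
Proof.
move=> c10 c20 m0 q0.
(* This [K] gives equality at the extreme values A = |M| + 1 and B = m. The number |M| + 1 is a
   positive upper bound for [A], which makes [K] positive. *)
exists (c1 * (`|M| + 1) / (c2 `^ q * m `^ q)).
have k0 : 0 < c2 `^ q * m `^ q by rewrite mulr_gt0 ?powR_gt0.
have M0 : 0 < `|M| + 1 by rewrite ltr_wpDl.
split=> [|A B AM mB]; first exact: divr_gt0 (mulr_gt0 c10 M0) k0.
have B0 : 0 < B by exact: lt_le_trans mB.
apply: (@le_trans _ _ (c1 * (`|M| + 1))).
  by rewrite ler_pM2l// (le_trans AM)// (le_trans (ler_norm M))// lerDl ler01.
have -> : c1 * (`|M| + 1) / (c2 `^ q * m `^ q) * c2 `^ q * B `^ q =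
    c1 * (`|M| + 1) * (c2 `^ q * B `^ q / (c2 `^ q * m `^ q)) by ring.
rewrite ler_peMr ?mulr_ge0 ?(ltW c10) ?(ltW M0)// ler_pdivlMr// mul1r.
rewrite ler_wpM2l ?powR_ge0//.
by apply: ge0_ler_powR => //; rewrite nnegrE ltW.
Qed.

Lemma hyp2F1_compare_nonneg (R : realType) (c1 c2 q a b g a' b' g' : R) :
  0 < c1 -> 0 < c2 -> 0 <= q ->
  0 < b -> b < g -> a + b < g -> 0 < b' -> b' < g' -> a' + b' < g' ->
  exists K : R, 0 < K /\ forall z x : R, 0 <= z < 1 -> x <= 1 ->
    x * c1 * hyp2F1 a b g z <= K * c2 `^ q * (hyp2F1 a' b' g' z) `^ q.
Proof.
move=> c10 c20 q0 b0 bg abg b'0 b'g' abg'.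
have [m [M [m0 HM]]] := hyp2F1_bounds_nonneg _ _ _ b0 bg abg.
have [m' [M' [m'0 Hm']]] := hyp2F1_bounds_nonneg _ _ _ b'0 b'g' abg'.
have [K [K0 HK]] := compare_bounds _ _ _ _ M _ c10 c20 m'0 q0.
exists K; split=> // z x z01 x1.
have /andP[h1 h2] := HM z z01; have /andP[h3 _] := Hm' z z01.
apply: le_trans (HK _ _ h2 h3).
rewrite -mulrA; apply: ler_piMl x1.
exact: mulr_ge0 (ltW c10) (le_trans (ltW m0) h1).
Qed.

(** The relation between [x], [a], [a'] and [q] says that both sides have the same power of 1 + t
    once t^x is enlarged to (1 + t)^x. The remaining normalised factors are bounded. *)
Lemma hyp2F1_compare_nonpos (R : realType) (c1 c2 q x a b g a' b' g' : R) :
  0 < c1 -> 0 < c2 -> 0 <= q -> 0 <= x -> x - a = - a' * q ->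
  0 < b -> b < g -> a < b -> 0 < b' -> b' < g' -> a' < b' ->
  exists K : R, 0 < K /\ forall t : R, 0 < t ->
    t `^ x * c1 * hyp2F1 a b g (- t) <=
    K * c2 `^ q * (hyp2F1 a' b' g' (- t)) `^ q.
Proof.
move=> c10 c20 q0 x0 xa b0 bg ab b'0 b'g' ab'.
have [m [M [m0 HM]]] := hyp2F1_bounds_nonpos _ _ _ b0 bg ab.
have [m' [M' [m'0 Hm']]] := hyp2F1_bounds_nonpos _ _ _ b'0 b'g' ab'.
have [K [K0 HK]] := compare_bounds _ _ _ _ M _ c10 c20 m'0 q0.
exists K; split=> // t t0; have t1 : 0 < 1 + t by lra.
have Nt : - t <= 0 by lra.
have := HM _ Nt; have := Hm' _ Nt; rewrite opprK.
set F := hyp2F1 a b g _; set F' := hyp2F1 a' b' g' _ => /andP[h3 _] /andP[h1 h2].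
have {HK} := HK _ _ h2 h3.
have pw r : 0 < (1 + t) `^ r by exact: powR_gt0.
have F0 : 0 < F by rewrite -(pmulr_rgt0 _ (pw a)); exact: (lt_le_trans m0 h1).
have F'0 : 0 < F' by rewrite -(pmulr_rgt0 _ (pw a')); exact: (lt_le_trans m'0 h3).
rewrite powRM ?(ltW F'0) ?(ltW (pw _))// -powRrM => HK.
have tx : t `^ x <= (1 + t) `^ x.
  by apply: ge0_ler_powR => //; rewrite ?nnegrE; lra.
apply: (@le_trans _ _ ((1 + t) `^ x * c1 * F)).
  rewrite -!mulrA; apply: ler_wpM2r tx.
  exact: mulr_ge0 (ltW c10) (ltW F0).
(* Multiplying by (1 + t)^(a' q) restores the normalised values on both sides: on the left the
   exponent a' q + x equals a. *)
rewrite -(ler_pM2l (pw (a' * q))).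
have e : (1 + t) `^ (a' * q) * (1 + t) `^ x = (1 + t) `^ a.
  rewrite -powRD; last by apply/implyP => _; rewrite gt_eqF.
  by congr (_ `^ _); rewrite -(subrK a x) xa; ring.
have -> : (1 + t) `^ (a' * q) * ((1 + t) `^ x * c1 * F) =
    c1 * ((1 + t) `^ a * F) by rewrite -e; ring.
by rewrite [leRHS]mulrCA.
Qed.

(** * Choice of parameters in the comparison lemmas *)

Theorem theorem4p2 (R : realType) (eta1 eta2 p : R)
    (eta1_gt0 : 0 < eta1) (eta2_gt0 : 0 < eta2) (p_ge1 : 1 <= p) :
  (forall c : R, c \in [:: -1; 0; 1] ->
    exists K : R, 0 < K /\
    forall b : R, 0 < b -> (b%:E < 1 / (1 - heaviside (- c))%:E)%E ->
      b `^ ((1 - heaviside c) / 2 * inv_conjugate p) *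
      ((eta1 - heaviside c + 1) / 2) *
      hyp2F1 ((1 + heaviside c - eta2) / 2)
             ((eta1 - heaviside c + 1) / 2)
             ((eta1 - heaviside c + 3) / 2) (c * b)
      <= K * ((p * eta1 - heaviside c + 1) / 2) `^ (1 / p) *
         (hyp2F1 ((1 + heaviside c - p * eta2) / 2)
                 ((p * eta1 - heaviside c + 1) / 2)
                 ((p * eta1 - heaviside c + 3) / 2) (c * b)) `^ (1 / p)) /\
  (exists K : R, 0 < K /\
    forall b : R, 0 < b ->
      (b / (1 + b)) `^ (1 / 2 * inv_conjugate p) *
      ((eta1 + 1) / 2) *
      hyp2F1 ((1 - eta2) / 2) 1 ((eta1 + 3) / 2) (b / (1 + b))
      <= K * ((p * eta1 + 1) / 2) `^ (1 / p) *
         (hyp2F1 ((1 - p * eta2) / 2) 1 ((p * eta1 + 3) / 2)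
                 (b / (1 + b))) `^ (1 / p)) /\
  (exists K : R, 0 < K /\
    forall b : R, 0 < b -> b < 1 ->
      eta1 / 2 *
      hyp2F1 (1 - eta2 / 2) (eta1 / 2) (1 + eta1 / 2) b
      <= K * (p * eta1 / 2) `^ (1 / p) *
         (hyp2F1 (1 - p * eta2 / 2) (p * eta1 / 2) (1 + p * eta1 / 2) b)
           `^ (1 / p)).
Proof.
have p0 : 0 < p by exact: lt_le_trans p_ge1.
have q0 : 0 <= 1 / p by rewrite divr_ge0 ?ltW.
have pi0 : 0 <= inv_conjugate p by rewrite inv_conjugateE// subr_ge0 invf_le1.
have pe1 : 0 < p * eta1 by exact: mulr_gt0.
have pe2 : 0 < p * eta2 by exact: mulr_gt0.
have H1 : heaviside (1 : R) = 1 by rewrite /heaviside ler01.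
have H0 : heaviside (0 : R) = 1 by rewrite /heaviside lexx.
have HN : heaviside (- 1 : R) = 0 by rewrite /heaviside lerNr oppr0 ler10.
split; last split.
- move=> c; rewrite !inE => /or3P[] /eqP ->.
  + rewrite HN.
    (* For c = -1 the conditions [a < b] and [a' < b'] amount to eta1 + eta2 > 0 and p (eta1 + eta2)
       > 0. *)
    have [|||||||||||K [K0 HK]] := @hyp2F1_compare_nonpos R ((eta1 - 0 + 1) / 2)
      ((p * eta1 - 0 + 1) / 2) (1 / p) ((1 - 0) / 2 * inv_conjugate p)
      ((1 + 0 - eta2) / 2) ((eta1 - 0 + 1) / 2) ((eta1 - 0 + 3) / 2)
      ((1 + 0 - p * eta2) / 2) ((p * eta1 - 0 + 1) / 2) ((p * eta1 - 0 + 3) / 2);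
      try lra.
    by rewrite inv_conjugateE//; field; rewrite gt_eqF.
    by exists K; split=> // b b0 _; rewrite mulN1r; exact: HK.
  + rewrite H0.
    (* Here gamma - beta = 1, so that [a + b < g] says alpha < 1, that is eta2 > 0. The argument is
       0, and the exponent of b vanishes because H(0) = 1. *)
    have [|||||||||K [K0 HK]] := @hyp2F1_compare_nonneg R ((eta1 - 1 + 1) / 2)
      ((p * eta1 - 1 + 1) / 2) (1 / p)
      ((1 + 1 - eta2) / 2) ((eta1 - 1 + 1) / 2) ((eta1 - 1 + 3) / 2)
      ((1 + 1 - p * eta2) / 2) ((p * eta1 - 1 + 1) / 2) ((p * eta1 - 1 + 3) / 2);
      try lra.
    exists K; split=> // b b0 _; rewrite mul0r; apply: HK; first by rewrite lexx ltr01.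
    by rewrite subrr !mul0r powRr0.
  + rewrite H1 HN.
    have [|||||||||K [K0 HK]] := @hyp2F1_compare_nonneg R ((eta1 - 1 + 1) / 2)
      ((p * eta1 - 1 + 1) / 2) (1 / p)
      ((1 + 1 - eta2) / 2) ((eta1 - 1 + 1) / 2) ((eta1 - 1 + 3) / 2)
      ((1 + 1 - p * eta2) / 2) ((p * eta1 - 1 + 1) / 2) ((p * eta1 - 1 + 3) / 2);
      try lra.
    (* For c = 1 the extended bound is 1, which places the argument b in [0, 1[. *)
    exists K; split=> // b b0; rewrite subr0 inve1 mule1 lte_fin => b1.
    rewrite (mul1r b); apply: HK; first by rewrite (ltW b0).
    by rewrite subrr !mul0r powRr0.
(* Since b / (1 + b) lies in [0, 1[, the comparison for nonnegative arguments applies directly,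
   instead of a Pfaff transformation of the case c = -1. *)
- have [|||||||||K [K0 HK]] := @hyp2F1_compare_nonneg R ((eta1 + 1) / 2)
    ((p * eta1 + 1) / 2) (1 / p)
    ((1 - eta2) / 2) 1 ((eta1 + 3) / 2)
    ((1 - p * eta2) / 2) 1 ((p * eta1 + 3) / 2); try lra.
  exists K; split=> // b b0.
  have b1 : 0 < 1 + b by lra.
  have z0 : 0 < b / (1 + b) by rewrite divr_gt0.
  have z1 : b / (1 + b) < 1 by rewrite ltr_pdivrMr//; lra.
  apply: HK; first by rewrite (ltW z0).
  rewrite -[leRHS](powRr0 (b / (1 + b))) ger_powR ?z0 ?(ltW z1)//.
  by rewrite mulr_ge0.
- have [|||||||||K [K0 HK]] := @hyp2F1_compare_nonneg R (eta1 / 2)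
    (p * eta1 / 2) (1 / p) (1 - eta2 / 2) (eta1 / 2) (1 + eta1 / 2)
    (1 - p * eta2 / 2) (p * eta1 / 2) (1 + p * eta1 / 2); try lra.
  exists K; split=> // b b0 b1.
  (* There is no power of b in this inequality, hence the prefactor 1. *)
  have := HK b 1; rewrite mul1r; apply=> //; first by rewrite (ltW b0).
Qed.
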